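(* Let $H$ be a complex Hilbert space and let $GL_{S}^{+}(H)$ be the set of positive isomorphisms in $L(H)$, with the topology induced by the operator norm. The map $$\mathcal{R}: GL_{S}^{+}(H)\rightarrow GL_{S}^{+}(H),\qquad L\mapsto L^{1/2},$$ where $L^{1/2}$ denotes the unique nonnegative square root of $L$, is a homeomorphism.
   Context: $L(H)$ is the Banach space of bounded linear operators $H\to H$ with the operator norm. An operator $L\in L(H)$ is an isomorphism if it is bijective with bounded inverse. A self-adjoint operator $L\in L(H)$ is called nonnegative if $\langle Lx,x\rangle\ge 0$ for all $x\in H$, and positive if $\langle Lx,x\rangle>0$ for all $x\in H$ with $\Vert x\Vert=1$. $GL_{S}^{+}(H)$ denotes the set of $L\in L(H)$ that are self-adjoint, positive and isomorphisms. Every nonnegative operator $L\in L(H)$ has a unique nonnegative square root, i.e. a unique nonnegative $R\in L(H)$ with $R^{2}=L$; it is denoted $L^{1/2}$. If $L\in GL_{S}^{+}(H)$ then $L^{1/2}\in GL_{S}^{+}(H)$, so that $\mathcal{R}$ is well defined. *)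

(* Defs.v *)
From HB Require Import structures.
From mathcomp Require Import all_boot all_order all_algebra sesquilinear.
From mathcomp Require Import complex.
From mathcomp Require Import all_classical all_reals all_analysis.

Set Implicit Arguments.
Unset Strict Implicit.
Unset Printing Implicit Defensive.

Import Order.TTheory GRing.Theory Num.Theory.
Import numFieldNormedType.Exports.

Local Open Scope classical_set_scope.
Local Open Scope complex_scope.
Local Open Scope ring_scope.

(* Complex scalars are [R[i]] with [R] the real numbers.  The norm of a normed
   module over [R[i]] takes values in [R[i]]; there [0 <= z] means that [z] is
   a nonnegative real.  The inner product is linear in its first argument and
   conjugate-linear in its second. *)
HB.mixin Record isHilbert (R : realType) H
    & CompleteNormedModule R[i] H := {
  inner : {dot H for @Num.conj R[i]} ;
  inner_norm : forall x : H, inner x x = `|x| ^+ 2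
}.

#[short(type="hilbertType")]
HB.structure Definition Hilbert (R : realType) :=
  {H of CompleteNormedModule R[i] H & isHilbert R H}.

Section BoundedOp.
Context {R : realType} (H : hilbertType R).

Definition bounded_linear : {pred H -> H} :=
  [pred f : H -> H | `[< linear f /\
     exists M : R, forall x, `|f x| <= M%:C * `|x| >]].

Lemma bounded_linearP (f : H -> H) :
  reflect (linear f /\ exists M : R, forall x, `|f x| <= M%:C * `|x|)
          (f \in bounded_linear).
Proof. exact: asboolP. Qed.

Let normcM (a : R[i]) (M : R) : (complex.Re `|a| * M)%:C = `|a| * M%:C.
Proof. by rewrite -[in RHS](RRe_real (normr_real a)) -rmorphM. Qed.

Lemma bounded_linear_submod : submod_closed bounded_linear.
Proof.
split.
  apply/bounded_linearP; split; first by move=> a x y; rewrite scaler0 addr0.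
  by exists 0 => x; rewrite normr0 mul0r.
move=> a f g /bounded_linearP[lf [M Mf]] /bounded_linearP[lg [N Ng]].
apply/bounded_linearP; split.
  move=> b x y; rewrite [LHS]/(a *: f (b *: x + y) + g (b *: x + y)).
  rewrite lf lg !scalerDr addrACA; congr (_ + _).
  by rewrite !scalerA mulrC.
exists (complex.Re `|a| * M + N) => x.
rewrite [X in `|X|]/(a *: f x + g x) (le_trans (ler_normD _ _))//.
rewrite rmorphD/= normcM mulrDl normrZ -mulrA.
by rewrite lerD// ler_wpM2l.
Qed.

HB.instance Definition _ :=
  GRing.isSubmodClosed.Build R[i] (H -> H) bounded_linear bounded_linear_submod.

Record boundedOp := BoundedOp {
  op_fun :> H -> H ;
  op_funP : op_fun \in bounded_linear
}.

HB.instance Definition _ := [isSub for op_fun].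
HB.instance Definition _ := [Choice of boundedOp by <:].
HB.instance Definition _ := [SubChoice_isSubLmodule of boundedOp by <:].

Implicit Types L S : boundedOp.

Lemma op_is_linear L : linear L.
Proof. by have /bounded_linearP[] := op_funP L. Qed.

HB.instance Definition _ L :=
  GRing.isLinear.Build R[i] H H *:%R (op_fun L) (op_is_linear L).

Lemma op_bounded L : exists M : R, forall x, `|L x| <= M%:C * `|x|.
Proof. by have /bounded_linearP[] := op_funP L. Qed.

(* The supremum is over the closed unit ball rather than the unit sphere, which
   is empty when [H] is trivial. *)
Definition opnorm L : R := sup [set complex.Re `|L x| | x in [set x | `|x| <= 1]].

Let ReK (x : H) : (complex.Re `|x|)%:C = `|x|.
Proof. by rewrite RRe_real ?normr_real. Qed.

Let opnorm_has_sup L :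
  has_sup [set complex.Re `|L x| | x in [set x | `|x| <= 1]].
Proof.
split; first by exists (complex.Re `|L 0|); exists 0 => //=; rewrite normr0.
have [M ML] := op_bounded L; exists `|M| => _ [x /= x1 <-].
rewrite -lecR ReK (le_trans (ML x))// (@le_trans _ _ (`|M|%:C * `|x|))//.
  by rewrite ler_wpM2r// lecR ler_norm.
by rewrite ler_piMr// lecR.
Qed.

Lemma opnorm_le L (M : R) : (forall x, `|x| <= 1 -> `|L x| <= M%:C) ->
  opnorm L <= M.
Proof.
move=> LM; apply: ge_sup; first by case: (opnorm_has_sup L).
by move=> _ [x /= x1 <-]; rewrite -lecR ReK LM.
Qed.

Lemma op_le_opnorm1 L x : `|x| <= 1 -> `|L x| <= (opnorm L)%:C.
Proof.
move=> x1; rewrite -ReK lecR; apply: sup_upper_bound => //.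
by exists x.
Qed.

Lemma opnorm_ge0 L : 0 <= opnorm L.
Proof.
by rewrite -lecR (le_trans _ (@op_le_opnorm1 L 0 _))// normr0.
Qed.

Lemma op_le_opnorm L x : `|L x| <= (opnorm L)%:C * `|x|.
Proof.
have [->|x0] := eqVneq x 0; first by rewrite linear0 !normr0 mulr0.
rewrite -ler_pdivrMr ?normr_gt0//.
have := @op_le_opnorm1 L (`|x|^-1 *: x).
rewrite linearZ/= !normrZ normfV normr_id mulVf ?normr_eq0// lexx mulrC.
exact.
Qed.

Let opnormD L S : (opnorm (L + S))%:C <= (opnorm L)%:C + (opnorm S)%:C.
Proof.
rewrite -rmorphD lecR; apply: opnorm_le => x x1.
rewrite [X in `|X|]/(L x + S x) (le_trans (ler_normD _ _))// rmorphD/=.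
by rewrite lerD// op_le_opnorm1.
Qed.

Let opnormZ_le (a : R[i]) L : (opnorm (a *: L))%:C <= `|a| * (opnorm L)%:C.
Proof.
rewrite -normcM lecR.
apply: opnorm_le => x x1.
rewrite [X in `|X|]/(a *: L x) normrZ normcM.
by rewrite ler_wpM2l// op_le_opnorm1.
Qed.

Let opnormZ (a : R[i]) L : (opnorm (a *: L))%:C = `|a| * (opnorm L)%:C.
Proof.
apply/eqP; rewrite eq_le opnormZ_le/=.
have [->|a0] := eqVneq a 0.
  by rewrite normr0 mul0r lecR opnorm_ge0.
rewrite -ler_pdivlMl ?normr_gt0//.
have := opnormZ_le a^-1 (a *: L).
by rewrite scalerA mulVf// scale1r normfV.
Qed.

Let opnorm0_eq0 L : (opnorm L)%:C = 0 -> L = 0.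
Proof.
move=> L0; apply/val_inj/funext => x; apply/eqP; rewrite -normr_le0.
by rewrite (le_trans (op_le_opnorm L x))// L0 mul0r.
Qed.

HB.instance Definition _ := Lmodule_isNormed.Build R[i] boundedOp
  opnormD opnormZ opnorm0_eq0.

Definition op_isomorphism L : Prop :=
  exists2 M : boundedOp, cancel L M & cancel M L.

Definition self_adjoint L : Prop :=
  forall x y, inner (L x) y = inner x (L y).

Definition op_nonneg L : Prop :=
  self_adjoint L /\ forall x, 0 <= inner (L x) x.

Definition op_pos L : Prop :=
  self_adjoint L /\ forall x, `|x| = 1 -> 0 < inner (L x) x.

Definition GLSp : set boundedOp := [set L | op_pos L /\ op_isomorphism L].

Definition nonneg_sqrt L S : Prop := op_nonneg S /\ S \o S = L.

End BoundedOp.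

Arguments GLSp {R} H.

Definition homeomorphism (X Y : topologicalType) (f : X -> Y) : Prop :=
  continuous f /\
  exists g : Y -> X, [/\ cancel f g, cancel g f & continuous g].

(* Main.v *)
Require Import Defs.
From mathcomp Require Import all_boot all_order all_algebra complex.
From mathcomp Require Import all_classical all_reals all_analysis.
From mathcomp Require Import sesquilinear ring lra.

(** The square root is built by a fixed point argument and controlled by one
    perturbation estimate.

    The estimate ([sqr_diff_ge]) says that if [A >= c > 0] and [B >= 0] then
    [c * |A - B| <= |A^2 - B^2|].  With [D = A - B] and [r] a large real,
    [2 r D = (r - A) D + D (r - B) + (A^2 - B^2)], and positivity gives
    [|r - A| <= r - c] and [|r - B| <= r], so the terms in [r] cancel.  Two
    consequences follow at once.  If [A^2 = B^2] then [A = B]: an operator with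
    a coercive square root has no other nonnegative one.  And if [A] and [B]
    are the roots of [L] and [L'], then [|A - B| <= c^-1 * |L - L'|]: the
    square root is Lipschitz at [L], with a constant depending on [L] only.

    For existence, an element [L] of [GLSp] satisfies [L >= c > 0]
    ([GLSp_ge]).  For [r] large put [T = 1 - L / r], so that [|T| <= q < 1].
    The map [Y |-> (T + Y^2) / 2] preserves the self-adjoint operators of norm
    at most [q] and contracts distances by [q]; since the bounded operators are
    complete it has a fixed point [Y], which satisfies [(1 - Y)^2 = 1 - T].
    Then [sqrt r * (1 - Y)] is a root of [L], and it is coercive because
    [|Y| <= q < 1].

    The inverse of the square root is squaring, which is continuous because
    [|A^2 - B^2| <= (|A| + |B|) * |A - B|]. *)

Set Implicit Arguments.
Unset Strict Implicit.
Unset Printing Implicit Defensive.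

Import Order.TTheory GRing.Theory Num.Theory.
Import numFieldNormedType.Exports.

Local Open Scope classical_set_scope.
Local Open Scope complex_scope.
Local Open Scope ring_scope.

Section PositiveSquareRoot.
Context {R : realType} {H : hilbertType R}.
Implicit Types (A B D L S T Y Z : boundedOp H) (x y z : H) (a c e m q r : R).

(** * Inner products *)

Lemma innerC x y : inner x y = (inner y x)^*.
Proof. by rewrite hermC expr0 mul1r. Qed.

Lemma innerDl x y z : inner (x + y) z = inner x z + inner y z.
Proof. exact: linearDl. Qed.
Lemma innerDr x y z : inner x (y + z) = inner x y + inner x z.
Proof. exact: linearDr. Qed.
Lemma innerBl x y z : inner (x - y) z = inner x z - inner y z.
Proof. exact: linearBl. Qed.
Lemma innerBr x y z : inner x (y - z) = inner x y - inner x z.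
Proof. exact: linearBr. Qed.
Lemma innerNl x y : inner (- x) y = - inner x y.
Proof. exact: linearNl. Qed.
Lemma innerNr x y : inner x (- y) = - inner x y.
Proof. exact: linearNr. Qed.
Lemma innerZl (k : R[i]) x y : inner (k *: x) y = k * inner x y.
Proof. exact: linearZl_LR. Qed.
Lemma innerZr (k : R[i]) x y : inner x (k *: y) = k^* * inner x y.
Proof. exact: linearZr_LR. Qed.
Lemma conjr a : (a%:C)^* = a%:C.
Proof. by apply: conj_Creal; apply/complex_realP; exists a. Qed.

(** Cauchy-Schwarz, from [0 <= |z|^2] for [z = |y|^2 x - <x, y> y]. *)
Lemma inner_le x y : `|inner x y| <= `|x| * `|y|.
Proof.
have [->|y0] := eqVneq y 0.
  by rewrite linear0r !normr0 mulr0.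
have y2 : 0 < `|y| ^+ 2 by rewrite exprn_gt0 ?normr_gt0.
have : 0 <= inner (`|y| ^+ 2 *: x - inner x y *: y)
                  (`|y| ^+ 2 *: x - inner x y *: y).
  by rewrite inner_norm exprn_ge0.
rewrite innerBl !innerBr !innerZl !innerZr !inner_norm.
rewrite (innerC y x) (conj_Creal (ger0_real (ltW y2))).
rewrite (_ : _ - _ = `|y| ^+ 2 * ((`|x| * `|y|) ^+ 2 - `|inner x y| ^+ 2)).
  by rewrite pmulr_rge0// subr_ge0 ler_pXn2r// nnegrE mulr_ge0.
rewrite normCK; ring.
Qed.

(** * Operator algebra and operator norm *)

Lemma opDE A B x : (A + B) x = A x + B x. Proof. by []. Qed.
Lemma opNE A x : (- A) x = - A x. Proof. by []. Qed.
Lemma opBE A B x : (A - B) x = A x - B x. Proof. by []. Qed.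
Lemma opZE (k : R[i]) A x : (k *: A) x = k *: A x. Proof. by []. Qed.
Lemma op0E x : (0 : boundedOp H) x = 0. Proof. by []. Qed.

Lemma op_comp_subproof A B : (A \o B) \in bounded_linear (H:=H).
Proof.
apply/bounded_linearP; split; first by move=> k x y /=; rewrite !linearP.
exists (opnorm A * opnorm B) => x /=.
rewrite (le_trans (op_le_opnorm A _))// rmorphM -mulrA ler_wpM2l//.
  by rewrite ler0c opnorm_ge0.
exact: op_le_opnorm.
Qed.
Definition op_comp A B := BoundedOp (op_comp_subproof A B).

Lemma op_compE A B x : op_comp A B x = A (B x). Proof. by []. Qed.

Lemma op_id_subproof : id \in bounded_linear (H:=H).
Proof. by apply/bounded_linearP; split=> //; exists 1 => x; rewrite mul1r. Qed.
Definition op_id := BoundedOp op_id_subproof.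

Lemma opnorm_bound A m : 0 <= m -> (forall x, `|A x| <= m%:C * `|x|) ->
  opnorm A <= m.
Proof.
move=> m0 Am; apply: opnorm_le => x x1; rewrite (le_trans (Am x))//.
by rewrite ler_piMr// ler0c.
Qed.

Lemma opnorm_comp A B : opnorm (op_comp A B) <= opnorm A * opnorm B.
Proof.
apply: opnorm_bound => [|x]; first by rewrite mulr_ge0 ?opnorm_ge0.
rewrite (le_trans (op_le_opnorm A _))// rmorphM -mulrA ler_wpM2l//.
  by rewrite ler0c opnorm_ge0.
exact: op_le_opnorm.
Qed.

Lemma op_norm A : `|A| = (opnorm A)%:C. Proof. by []. Qed.

Lemma opnormD A B : opnorm (A + B) <= opnorm A + opnorm B.
Proof. by rewrite -lecR rmorphD -!op_norm ler_normD. Qed.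

Lemma opnormN A : opnorm (- A) = opnorm A.
Proof. by apply: (@complexI R); rewrite -!op_norm normrN. Qed.

Lemma opnormB A B : opnorm (A - B) <= opnorm A + opnorm B.
Proof. by rewrite -(opnormN B) opnormD. Qed.

Lemma opnormZ a A : 0 <= a -> opnorm (a%:C *: A) = a * opnorm A.
Proof.
move=> a0; apply: (@complexI R).
by rewrite -op_norm normrZ ger0_norm ?ler0c// rmorphM.
Qed.

Lemma opP A B : A =1 B -> A = B.
Proof. by move=> AB; apply/val_inj/funext. Qed.

(** * Forms of self-adjoint operators *)

Lemma self_adjointD A B : self_adjoint A -> self_adjoint B ->
  self_adjoint (A + B).
Proof. by move=> sA sB x y; rewrite !opDE innerDl innerDr sA sB. Qed.

Lemma self_adjointZ a A : self_adjoint A -> self_adjoint (a%:C *: A).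
Proof. by move=> sA x y; rewrite !opZE innerZl innerZr conjr sA. Qed.

Lemma self_adjointN A : self_adjoint A -> self_adjoint (- A).
Proof. by move=> sA x y; rewrite !opNE innerNl innerNr sA. Qed.

Lemma self_adjoint_id : self_adjoint op_id. Proof. by []. Qed.

Lemma self_adjoint_sqr A : self_adjoint A -> self_adjoint (op_comp A A).
Proof. by move=> sA x y; rewrite !op_compE !sA. Qed.

Lemma self_adjoint_real A x : self_adjoint A -> inner (A x) x \is Num.real.
Proof. by move=> sA; rewrite CrealE -innerC sA. Qed.

(** Expanding the nonnegative quantity [<D z, z>] at [z = D x - m x] is a
    shortcut for the Cauchy-Schwarz inequality of the form [<D x, y>]. *)
Lemma form_bound_sqr D m : 0 < m -> op_nonneg D ->
  (forall x, inner (D x) x <= m%:C * `|x| ^+ 2) ->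
  forall x, `|D x| ^+ 2 <= m%:C * inner (D x) x.
Proof.
move=> m0 [sD D0] Dm x.
have m0C : 0 < m%:C by rewrite ltcR.
have := D0 (D x - m%:C *: x).
rewrite (_ : D (_ - _) = D (D x) - m%:C *: D x); last first.
  by rewrite linearB linearZ.
rewrite innerBl !innerBr !innerZl !innerZr conjr.
rewrite (sD (D x) x) inner_norm.
move/le_trans=> /(_ (m%:C * (m%:C * inner (D x) x - `|D x| ^+ 2))).
rewrite pmulr_rge0// subr_ge0; apply.
rewrite mulrBr -subr_ge0.
have := Dm (D x); rewrite -subr_ge0.
by congr (0 <= _); ring.
Qed.

Lemma opnorm_le_form D m : 0 < m -> op_nonneg D ->
  (forall x, inner (D x) x <= m%:C * `|x| ^+ 2) -> opnorm D <= m.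
Proof.
move=> m0 D0 Dm; apply: opnorm_le => x x1.
have m0C : 0 < m%:C by rewrite ltcR.
rewrite -(@ler_pXn2r _ 2)// ?nnegrE ?(ltW m0C)//.
rewrite (le_trans (form_bound_sqr m0 D0 Dm x))//.
rewrite expr2 ler_pM2l// (le_trans (Dm x))//.
by rewrite ler_piMr ?(ltW m0C)// exprn_ile1.
Qed.

Lemma inner_op_le A x : self_adjoint A ->
  inner (A x) x <= (opnorm A)%:C * `|x| ^+ 2.
Proof.
move=> sA; apply: (le_trans (real_ler_norm (self_adjoint_real _ sA))).
apply: (le_trans (inner_le _ _)).
by rewrite expr2 mulrA ler_wpM2r// op_le_opnorm.
Qed.

(** * Coercive operators and the perturbation estimate *)

Definition op_ge A c := forall x, c%:C * `|x| ^+ 2 <= inner (A x) x.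

Lemma inner_shift A r x :
  inner ((r%:C *: op_id - A) x) x = r%:C * `|x| ^+ 2 - inner (A x) x.
Proof. by rewrite opDE opNE opZE innerBl innerZl inner_norm. Qed.

(** From [c <= A <= r] follows [0 <= r - A <= r - c], and a nonnegative operator
    has norm at most any bound on its form. *)
Lemma opnorm_shift A r c : self_adjoint A -> op_ge A c ->
  opnorm A <= r -> c < r -> opnorm (r%:C *: op_id - A) <= r - c.
Proof.
move=> sA Ac Ar cr; apply: opnorm_le_form; first by rewrite subr_gt0.
- split.
    apply: self_adjointD; last exact: self_adjointN.
    exact/self_adjointZ/self_adjoint_id.
  move=> x; rewrite inner_shift subr_ge0.
  rewrite (le_trans (inner_op_le x sA))// ler_wpM2r ?exprn_ge0// lecR//.
- by move=> x; rewrite inner_shift rmorphB /= mulrBl lerD2l lerN2.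
Qed.

(** The perturbation estimate behind both uniqueness and continuity of the
    square root.  Coercivity is asked of [A] only, so that [B] may be any
    nonnegative root in the uniqueness statement. *)
Lemma sqr_diff_ge A B c : 0 < c -> self_adjoint A -> op_ge A c ->
  op_nonneg B -> c * opnorm (A - B) <= opnorm (op_comp A A - op_comp B B).
Proof.
move=> c0 sA Ac [sB B0].
set D := A - B; set E := op_comp A A - op_comp B B.
(* Any [r] above [|A|], [|B|] and [c] works: it cancels at the end. *)
pose r := opnorm A + opnorm B + c + 1.
have A0 := opnorm_ge0 A; have nB0 := opnorm_ge0 B.
have r0 : 0 < r by rewrite /r; lra.
have nP : opnorm (r%:C *: op_id - A) <= r - c.
  by apply: opnorm_shift => //; rewrite /r; lra.
have nQ : opnorm (r%:C *: op_id - B) <= r.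
  rewrite -[leRHS]subr0; apply: opnorm_shift => //; last by rewrite /r; lra.
    by move=> x; rewrite mul0r.
set P := (_ - A) in nP; set Q := (_ - B) in nQ.
have DE : (2 * r)%:C *: D = op_comp P D + op_comp D Q + E.
  apply: opP => x.
  transitivity (P (D x) + D (Q x) + E x); last by [].
  have -> : P (D x) = r%:C *: D x - A (D x) by [].
  have -> : D (Q x) = r%:C *: D x - D (B x).
    by rewrite [LHS](linearB D (r%:C *: x) (B x)) linearZ.
  have -> : E x = A (D x) + D (B x).
    by rewrite [A _](linearB A (A x) (B x)) addrA subrK.
  by rewrite [X in _ = X + _]addrACA -opprD subrK -scalerDl -rmorphD mulrDl mul1r.
have := lexx (opnorm ((2 * r)%:C *: D)).
rewrite {2}DE opnormZ; last by lra.
move/le_trans => /(_ _ (opnormD _ _)).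
have h1 := opnormD (op_comp P D) (op_comp D Q).
have h2 : opnorm (op_comp P D) <= (r - c) * opnorm D.
  by rewrite (le_trans (opnorm_comp _ _))// ler_wpM2r// opnorm_ge0.
have h3 : opnorm (op_comp D Q) <= opnorm D * r.
  by rewrite (le_trans (opnorm_comp _ _))// ler_wpM2l// opnorm_ge0.
lra.
Qed.

Lemma op_pos_nonneg L : op_pos L -> op_nonneg L.
Proof.
move=> [sL L0]; split=> // x.
have [->|x0] := eqVneq x 0; first by rewrite linear0r.
have nx0 : 0 < `|x| by rewrite normr_gt0.
have := L0 (`|x|^-1 *: x).
rewrite normrZ normfV normr_id mulVf ?gt_eqF// => /(_ erefl).
rewrite [L _]linearZ innerZl innerZr => /ltW.
rewrite pmulr_rge0 ?invr_gt0// conj_Creal ?ger0_real ?invr_ge0//.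
by rewrite pmulr_rge0 ?invr_gt0.
Qed.

(** A positive isomorphism is coercive: if [M] is its inverse and [r > |L|]
    then [|x| <= |M| * |L x|] and [|L x|^2 <= r <L x, x>]. *)
Lemma GLSp_ge L : GLSp H L -> exists2 c, 0 < c & op_ge L c.
Proof.
move=> [/op_pos_nonneg nL [M LM ML]].
pose r := opnorm L + 1; pose m := opnorm M + 1.
have r0 : 0 < r by rewrite ltr_wpDl ?opnorm_ge0.
have m0 : 0 < m by rewrite ltr_wpDl ?opnorm_ge0.
exists (r * m ^+ 2)^-1 => [|x]; first by rewrite invr_gt0 mulr_gt0 ?exprn_gt0.
rewrite rmorphV ?unitfE ?gt_eqF ?mulr_gt0 ?exprn_gt0// ler_pdivrMl; last first.
  by rewrite ltcR mulr_gt0 ?exprn_gt0.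
have Lr y : inner (L y) y <= r%:C * `|y| ^+ 2.
  rewrite (le_trans (inner_op_le y nL.1))// ler_wpM2r ?exprn_ge0// lecR.
  by rewrite lerDl.
have m2C : 0 < (m ^+ 2)%:C by rewrite ltcR exprn_gt0.
have /le_trans : `|x| ^+ 2 <= (m ^+ 2)%:C * `|L x| ^+ 2.
  rewrite rmorphXn -exprMn ler_pXn2r ?nnegrE ?mulr_ge0 ?ler0c ?(ltW m0)//.
  rewrite -{1}(LM x) (le_trans (op_le_opnorm M _))// ler_wpM2r// lecR.
  by rewrite lerDl.
rewrite [X in _ -> _ <= X * _](_ : _ = (m ^+ 2)%:C * r%:C); last first.
  by rewrite -rmorphM [_ * r]mulrC.
rewrite -mulrA; apply.
by rewrite ler_pM2l// (form_bound_sqr r0 nL Lr).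
Qed.

(** * Completeness of the space of bounded operators *)

Lemma gt0_realE (e : R[i]) : 0 < e -> exists2 a, 0 < a & e = a%:C.
Proof.
move=> e0; have /complex_realP[a ea] := gtr0_real e0.
by exists a => //; rewrite -ltcR -ea.
Qed.

Lemma normr_realE x : exists2 a, 0 <= a & `|x| = a%:C.
Proof.
have /complex_realP[a xa] := normr_real x.
by exists a => //; rewrite -ler0c -xa.
Qed.

(** The Banach space of bounded operators: the limit is taken pointwise in [H],
    and the Cauchy estimate, being uniform in [x], passes to the limit. *)
Lemma bounded_op_complete (Y_ : nat -> boundedOp H) :
  (forall e : R, 0 < e -> exists N, forall m n : nat, (N <= m)%N -> (N <= n)%N ->
     opnorm (Y_ m - Y_ n) <= e) ->
  exists Y, forall e : R, 0 < e -> exists N, forall n, (N <= n)%N ->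
     opnorm (Y - Y_ n) <= e.
Proof.
move=> cY.
have cYx x : cvg (Y_ n x @[n --> \oo]).
  apply/cauchy_cvgP; apply: cauchy_exP => _ /gt0_realE[e e0 ->].
  have [a a0 xa] := normr_realE x.
  have [|N YN] := cY (e / (a + 1)); first by rewrite divr_gt0// ltr_wpDl.
  exists (Y_ N x); exists N => // n /= Nn.
  rewrite -ball_normE /= (le_lt_trans (op_le_opnorm (Y_ N - Y_ n) x))//.
  rewrite xa -rmorphM ltcR.
  rewrite (le_lt_trans (ler_wpM2r a0 (YN _ _ (leqnn _) Nn)))//.
  by rewrite mulrAC ltr_pdivrMr ?ltr_wpDl// ltr_pM2l// ltrDl.
pose f x : H := lim (Y_ n x @[n --> \oo]).
have fx x : Y_ n x @[n --> \oo] --> f x by exact: cYx.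
have near_f e : 0 < e -> exists N, forall n, (N <= n)%N -> forall x,
    `|f x - Y_ n x| <= e%:C * `|x|.
  move=> /cY[N YN]; exists N => n Nn x; apply/ler_addgt0Pr => d d0.
  have /cvgrPdist_le/(_ d d0) [M _ fM] := fx x.
  have := fM (maxn M N) (leq_maxl _ _).
  set k := maxn M N => fk.
  rewrite -(subrKA (Y_ k x)) [leRHS]addrC (le_trans (ler_normD _ _))//.
  rewrite lerD// (le_trans (op_le_opnorm (Y_ k - Y_ n) x))//.
  by rewrite ler_wpM2r// lecR YN// leq_maxr.
have flin : linear f.
  move=> k x y; apply: (cvg_unique (@norm_hausdorff _ H) (fx _)) => /=.
  rewrite (_ : (fun n => _) = (fun n => k *: Y_ n x + Y_ n y)).
    by apply: cvgD; [exact: cvgZr|].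
  by apply/funext => n; rewrite linearP.
have fB : f \in bounded_linear (H:=H).
  apply/bounded_linearP; split => //.
  have [N fN] := near_f 1 ltr01; exists (1 + opnorm (Y_ N)) => x.
  rewrite -(subrK (Y_ N x) (f x)) (le_trans (ler_normD _ _))//.
  by rewrite rmorphD mulrDl lerD ?fN// op_le_opnorm.
exists (BoundedOp fB) => e e0; have [N fN] := near_f e e0.
exists N => n Nn; apply: opnorm_bound; first exact: ltW.
by move=> x; exact: (fN n Nn x).
Qed.

(** * The fixed point iteration for the square root *)

(** Its fixed points are the [Y] with [(1 - Y)^2 = 1 - T]. *)
Definition root_step T Y : boundedOp H := (2^-1)%:C *: (T + op_comp Y Y).

Lemma opnorm_root_step q T Y : 0 <= q <= 1 -> opnorm T <= q -> opnorm Y <= q ->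
  opnorm (root_step T Y) <= q.
Proof.
move=> /andP[q0 q1] Tq Yq; rewrite opnormZ ?invr_ge0//.
have YY : opnorm (op_comp Y Y) <= q * q.
  by rewrite (le_trans (opnorm_comp _ _))// ler_pM ?opnorm_ge0.
have := opnormD T (op_comp Y Y).
have : q * q <= q by rewrite ler_piMr.
lra.
Qed.

Lemma opnorm_sqrB Y Z : opnorm (op_comp Y Y - op_comp Z Z) <=
  (opnorm Y + opnorm Z) * opnorm (Y - Z).
Proof.
rewrite (_ : _ - _ = op_comp Y (Y - Z) + op_comp (Y - Z) Z); last first.
  apply: opP => x.
  transitivity (Y (Y x) - Z (Z x)); first by [].
  transitivity (Y (Y x - Z x) + (Y (Z x) - Z (Z x))); last by [].
  by rewrite linearB addrA subrK.
rewrite (le_trans (opnormD _ _))// mulrDl.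
by rewrite lerD ?opnorm_comp// [leRHS]mulrC opnorm_comp.
Qed.

Lemma root_step_contraction q T Y Z : opnorm Y <= q -> opnorm Z <= q ->
  opnorm (root_step T Y - root_step T Z) <= q * opnorm (Y - Z).
Proof.
move=> Yq Zq; rewrite -scalerBr opnormZ ?invr_ge0//.
rewrite opprD addrACA subrr add0r.
have := opnorm_sqrB Y Z.
have : (opnorm Y + opnorm Z) * opnorm (Y - Z) <= (q + q) * opnorm (Y - Z).
  by rewrite ler_wpM2r ?opnorm_ge0// lerD.
lra.
Qed.

(** The defect [<Y x, y> - <x, Y y>] is that of [Y - Y_ n], hence it is at most
    [2 |Y - Y_ n| |x| |y|]. *)
Lemma self_adjoint_limit Y (Y_ : nat -> boundedOp H) :
  (forall n, self_adjoint (Y_ n)) ->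
  (forall e : R, 0 < e -> exists n, opnorm (Y - Y_ n) <= e) -> self_adjoint Y.
Proof.
move=> sY YY x y; apply/eqP; rewrite -subr_eq0 -normr_le0.
apply/ler_addgt0Pr => _ /gt0_realE[e e0 ->]; rewrite add0r.
have [a a0 xa] := normr_realE x; have [b b0 yb] := normr_realE y.
have k0 : 0 < 2 * (a * b) + 1 by rewrite ltr_wpDl// !mulr_ge0.
pose e' := e / (2 * (a * b) + 1).
have [|n Yn] := YY e'; first by rewrite divr_gt0.
have -> : inner (Y x) y - inner x (Y y) =
    inner ((Y - Y_ n) x) y - inner x ((Y - Y_ n) y).
  by rewrite !opBE innerBl innerBr sY opprB addrA subrK.
rewrite (le_trans (ler_normB _ _))//.
have Zx z (d : R) : `|z| = d%:C -> `|(Y - Y_ n) z| <= (e' * d)%:C.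
  move=> zd; have d0 : 0 <= d%:C by rewrite -zd.
  rewrite (le_trans (op_le_opnorm _ _))// zd rmorphM.
  by apply: ler_wpM2r => //; rewrite lecR.
apply: (@le_trans _ _ (2 * (e' * (a * b)))%:C).
  rewrite mulrDl mul1r rmorphD lerD//.
    rewrite (le_trans (inner_le _ _))// mulrA rmorphM yb.
    by rewrite ler_wpM2r ?ler0c// Zx.
  rewrite (le_trans (inner_le _ _))// mulrCA rmorphM xa.
  by rewrite ler_wpM2l ?ler0c// Zx.
rewrite lecR mulrCA /e' mulrAC ler_pdivrMr// ler_pM2l//; lra.
Qed.

(** The Banach fixed point theorem for [root_step T] on the ball of radius [q],
    started at [0] so that every iterate is self-adjoint. *)
Lemma root_step_fixpoint q T : 0 <= q < 1 -> self_adjoint T -> opnorm T <= q ->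
  exists Y, [/\ self_adjoint Y, opnorm Y <= q & root_step T Y = Y].
Proof.
move=> /andP[q0 q1] sT Tq; have q01 : 0 <= q <= 1 by rewrite q0 ltW.
pose Y_ n := iter n (root_step T) 0.
have n0 : opnorm (0 : boundedOp H) = 0.
  by apply: (@complexI R); rewrite -op_norm normr0.
have Yq n : opnorm (Y_ n) <= q.
  by elim: n => [|n IH]; [rewrite n0|exact: opnorm_root_step].
have sY n : self_adjoint (Y_ n).
  elim: n => [|n IH]; first by move=> x y; rewrite !op0E linear0l linear0r.
  exact/self_adjointZ/self_adjointD/self_adjoint_sqr.
have dY n : opnorm (root_step T (Y_ n) - Y_ n) <= q ^+ n.
  elim: n => [|n IH].
    by rewrite subr0 expr0 (le_trans (opnorm_root_step q01 Tq _)) ?n0// ltW.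
  by rewrite exprS (le_trans (root_step_contraction _ (Yq n.+1) (Yq n)))//
    ler_wpM2l.
(* The residuals of two points bound their distance, which gives the Cauchy
   property without summing a geometric series. *)
have dist Y Z : opnorm Y <= q -> opnorm Z <= q -> (1 - q) * opnorm (Y - Z) <=
    opnorm (root_step T Y - Y) + opnorm (root_step T Z - Z).
  move=> Yq' Zq; rewrite mulrBl mul1r lerBlDl.
  have /le_trans : opnorm (Y - Z) <= opnorm (root_step T Y - root_step T Z) +
      (opnorm (root_step T Y - Y) + opnorm (root_step T Z - Z)).
    have -> : Y - Z = root_step T Y - root_step T Z -
        ((root_step T Y - Y) - (root_step T Z - Z)).
      rewrite !opprB; move: (root_step T Y) (root_step T Z) => FY FZ.
      by rewrite -[FZ - Z + _]addrA subrKA [RHS]addrC -addrA subrK addrC.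
    rewrite (le_trans (opnormB _ _))// lerD2l.
    exact: opnormB.
  by apply; rewrite lerD2r root_step_contraction.
have qn e : 0 < e -> exists N, forall n, (N <= n)%N -> q ^+ n <= e.
  move=> e0; have /cvg_expr/cvgrPdist_le/(_ e e0)[N _ qN] : `|q| < 1.
    by rewrite ger0_norm.
  exists N => n /qN; rewrite sub0r normrN ger0_norm ?exprn_ge0//.
have [|Y YY] := bounded_op_complete (Y_ := Y_).
  move=> e e0; have [|N qN] := qn ((1 - q) * e / 2).
    by rewrite divr_gt0// mulr_gt0// subr_gt0.
  exists N => m n /qN qm /qN qn'.
  rewrite -(@ler_pM2l _ (1 - q)) ?subr_gt0//.
  rewrite (le_trans (dist _ _ (Yq m) (Yq n)))//.
  have := dY m; have := dY n; lra.
have Yq' : opnorm Y <= q.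
  apply/ler_addgt0Pr => e /YY[N /(_ N (leqnn _)) YN].
  rewrite -(subrK (Y_ N) Y) addrC [q + e]addrC.
  rewrite addrC (le_trans (opnormD _ _))// lerD//.
exists Y; split => //.
  apply: (self_adjoint_limit sY) => e /YY[N YN]; exists N; exact: YN.
apply/eqP; rewrite -subr_eq0 -normr_le0 op_norm -(rmorph0 (real_complex R)) lecR.
apply/ler_addgt0Pr => e e0; rewrite add0r.
have e3 : 0 < e / 3 by rewrite divr_gt0.
have thirds : e / 3 + (e / 3 + e / 3) = e by field.
have [N YN] := YY _ e3; have [M qM] := qn _ e3.
pose n := maxn M N.
have h1 := YN n (leq_maxr _ _); have h2 := qM n (leq_maxl _ _).
have h3 := dY n.
have h4 := root_step_contraction T Yq' (Yq n).
have h5 : q * opnorm (Y - Y_ n) <= opnorm (Y - Y_ n).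
  by rewrite ler_piMl ?opnorm_ge0// ltW.
have -> : root_step T Y - Y = root_step T Y - root_step T (Y_ n) +
    ((root_step T (Y_ n) - Y_ n) - (Y - Y_ n)).
  by rewrite opprB !subrKA.
have h6 := opnormB (root_step T (Y_ n) - Y_ n) (Y - Y_ n).
rewrite (le_trans (opnormD _ _))//.
rewrite (le_trans (lerD (le_trans h4 (le_trans h5 h1))
  (le_trans h6 (lerD (le_trans h3 h2) h1))))//.
by rewrite thirds.
Qed.

(** * Square roots of coercive operators *)

(** The scaling by a real [r > |L|] reduces the problem to a root of [1 - T] with
    [|T| < 1]. *)
Lemma coercive_sqrt L c : 0 < c -> self_adjoint L -> op_ge L c ->
  exists S, exists2 d : R, 0 < d &
    [/\ self_adjoint S, op_ge S d & op_comp S S = L].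
Proof.
move=> c0 sL Lc.
(* The bound [r - c] on [|r - L|] asks for [r > c], which does not follow from
   [r > |L|] when [H] is zero. *)
pose r := opnorm L + c + 1; pose q := (r - c) / r.
have L0 := opnorm_ge0 L.
have r0 : 0 < r by rewrite /r; lra.
have rc : c < r by rewrite /r; lra.
have q0 : 0 <= q by rewrite divr_ge0 ?subr_ge0 ?ltW.
have q1 : q < 1 by rewrite ltr_pdivrMr// mul1r ltrBlDr ltrDl.
pose T : boundedOp H := r^-1%:C *: (r%:C *: op_id - L).
have sT : self_adjoint T.
  apply/self_adjointZ/self_adjointD; last exact: self_adjointN.
  exact/self_adjointZ/self_adjoint_id.
have Tq : opnorm T <= q.
  rewrite opnormZ ?invr_ge0 ?(ltW r0)// mulrC ler_pM2r ?invr_gt0//.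
  by apply: opnorm_shift => //; rewrite /r; lra.
have q01 : 0 <= q < 1 by rewrite q0.
have [Y [sY Yq YE]] := root_step_fixpoint q01 sT Tq.
pose s := Num.sqrt r; have s0 : 0 < s by rewrite sqrtr_gt0.
pose S : boundedOp H := s%:C *: (op_id - Y).
exists S, (s * (1 - q)); first by rewrite mulr_gt0// subr_gt0.
split.
- apply/self_adjointZ/self_adjointD; last exact: self_adjointN.
  exact: self_adjoint_id.
- move=> x; have -> : S x = s%:C *: (x - Y x) by [].
  rewrite innerZl innerBl inner_norm rmorphM -mulrA ler_pM2l ?ltcR//.
  rewrite rmorphB rmorph1 mulrBl mul1r lerD2l lerN2.
  rewrite (le_trans (inner_op_le x sY))// ler_wpM2r ?exprn_ge0// lecR//.
- apply: opP => x.
  have Yx : Y x + Y x = T x + Y (Y x).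
    have := congr1 (fun A : boundedOp H => A x) YE.
    rewrite -[X in X = _ -> _]/((2^-1)%:C *: (T x + Y (Y x))) => YxE.
    rewrite -{1 2}YxE -scalerDl -rmorphD.
    by rewrite (_ : 2^-1 + 2^-1 = 1) ?scale1r//; lra.
  transitivity (s%:C *: (s%:C *: (x - Y x) - Y (s%:C *: (x - Y x)))); first by [].
  have -> : Y (s%:C *: (x - Y x)) = s%:C *: (Y x - Y (Y x)).
    by rewrite linearZ linearB.
  rewrite -scalerBr scalerA -rmorphM -expr2 sqr_sqrtr ?ltW//.
  have -> : x - Y x - (Y x - Y (Y x)) = x - T x.
    have -> : T x = Y x + Y x - Y (Y x) by rewrite Yx addrK.
    by rewrite -addrA -opprD addrA.
  rewrite -[T x]/(r^-1%:C *: (r%:C *: x - L x)) scalerBr scalerA -rmorphM.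
  by rewrite divff ?gt_eqF// scale1r opprB addrC subrK.
Qed.

Lemma sqrt_unique A B c : 0 < c -> self_adjoint A -> op_ge A c ->
  op_nonneg B -> op_comp A A = op_comp B B -> A = B.
Proof.
move=> c0 sA Ac nB AB; have := sqr_diff_ge c0 sA Ac nB.
rewrite AB subrr => h; apply/eqP; rewrite -subr_eq0 -normr_le0 op_norm.
rewrite -(rmorph0 (real_complex R)) lecR -(pmulr_rle0 _ c0) (le_trans h)//.
by rewrite -lecR -op_norm normr0.
Qed.

Lemma GLSp_sqr S : GLSp H S -> GLSp H (op_comp S S).
Proof.
move=> [pS [M SM MS]]; have [sS _] := op_pos_nonneg pS; split.
  split; first exact: self_adjoint_sqr.
  move=> x x1; rewrite op_compE sS inner_norm exprn_gt0// normr_gt0.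
  apply/eqP => Sx0; move: x1; rewrite -(SM x) Sx0 linear0 normr0 => /eqP.
  by rewrite eq_sym oner_eq0.
by exists (op_comp M M) => x; rewrite !op_compE ?SM// ?MS.
Qed.

(** If [M] inverts [S^2] then [S M] is a right inverse of [S], and it is a left
    inverse because [S] is injective. *)
Lemma GLSp_sqrt S d : 0 < d -> self_adjoint S -> op_ge S d ->
  op_isomorphism (op_comp S S) -> GLSp H S.
Proof.
move=> d0 sS Sd [M LM ML]; split.
  by split=> // x x1; rewrite (lt_le_trans _ (Sd x))// x1 expr1n mulr1 ltcR.
exists (op_comp S M) => x; last exact: ML.
have Sinj : injective S.
  by move=> y z yz; apply: (can_inj LM); rewrite !op_compE yz.
apply: Sinj; exact: (ML (S x)).
Qed.

Lemma sqrt_exists L : GLSp H L -> exists2 S, GLSp H S & op_comp S S = L.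
Proof.
move=> GL; have [c c0 Lc] := GLSp_ge GL.
have [S [d d0 [sS Sd SL]]] := coercive_sqrt c0 (op_pos_nonneg GL.1).1 Lc.
by exists S => //; apply: GLSp_sqrt d0 sS Sd _; rewrite SL; exact: GL.2.
Qed.

(** [GLSp H] carries the initial topology of its inclusion, so continuity is
    tested after [set_val]; there the complex-valued norm and radii are real. *)
Lemma GLSp_continuous (f : GLSp H -> GLSp H) :
  (forall (L : GLSp H) (e : R), 0 < e ->
    exists2 d : R, 0 < d & forall L' : GLSp H,
     opnorm (set_val L - set_val L') <= d ->
     opnorm (set_val (f L) - set_val (f L')) <= e) ->
  continuous f.
Proof.
move=> fc; suff fL (L : GLSp H) :
    set_val (f L') @[L' --> L] --> (set_val (f L) : boundedOp H).
  apply: continuous_comp_initial => L; exact: fL.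
have sc : set_val L' @[L' --> L] --> (set_val L : boundedOp H).
  exact: initial_continuous.
apply/(@cvgrPdist_le _ _ _ _ (nbhs_filter L)) => _ /gt0_realE[e e0 ->].
have [d d0 fd] := fc L e e0.
have dC : 0 < d%:C by rewrite ltcR.
have /(@cvgrPdist_le _ _ _ _ (nbhs_filter L))/(_ _ dC) := sc.
apply: (@filterS _ _ (nbhs_filter L)) => L' /=; rewrite !op_norm !lecR; exact: fd.
Qed.

End PositiveSquareRoot.

(** * The homeomorphism *)

Theorem theorem5p5 (R : realType) (H : hilbertType R) :
  exists sqrt_map : GLSp H -> GLSp H,
    (forall L : GLSp H, unique (nonneg_sqrt (set_val L)) (set_val (sqrt_map L))) /\
    homeomorphism sqrt_map.
Proof.
have mk (S : boundedOp H) : GLSp H S -> {S' : GLSp H | set_val S' = S}.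
  by move=> GS; exists (exist _ S (mem_set GS)).
have GLv (L : GLSp H) : GLSp H (set_val L) by exact: set_mem (valP L).
have valI : injective (set_val : GLSp H -> boundedOp H) by exact: val_inj.
have /boolp.choice[f fE] : forall L : GLSp H, exists S : GLSp H,
    op_comp (set_val S) (set_val S) = set_val L.
  move=> L; have [S /mk[S' S'E] SL] := sqrt_exists (GLv L).
  by exists S'; rewrite S'E.
have /boolp.choice[g gE] : forall S : GLSp H, exists L : GLSp H,
    set_val L = op_comp (set_val S) (set_val S).
  by move=> S; have [L LE] := mk _ (GLSp_sqr (GLv S)); exists L.
(* Elements of [GLSp H] are coercive, so no nonnegative operator other than
   themselves has the same square. *)
have uniq (S : GLSp H) B : op_nonneg B ->
    op_comp (set_val S) (set_val S) = op_comp B B -> set_val S = B.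
  have [c c0 Sc] := GLSp_ge (GLv S).
  exact: sqrt_unique c0 (op_pos_nonneg (GLv S).1).1 Sc.
have nn (S : GLSp H) : op_nonneg (set_val S) by exact: op_pos_nonneg (GLv S).1.
exists f; split.
  move=> L; split; first by split; [exact: nn|rewrite -(fE L)].
  move=> B [nB BL]; apply: uniq => //; rewrite fE.
  by apply: opP => x; rewrite -BL.
split.
  apply: GLSp_continuous => L e e0.
  have [c c0 fc] := GLSp_ge (GLv (f L)).
  (* [c] is a coercivity constant of the root of [L], not of [L] itself. *)
  exists (c * e); first exact: mulr_gt0.
  move=> L' LL'; rewrite -(ler_pM2l c0) (le_trans _ LL')//.
  rewrite -(fE L) -(fE L'); exact: sqr_diff_ge c0 (nn (f L)).1 fc (nn (f L')).
exists g; split.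
- by move=> L; apply: valI; rewrite gE fE.
- by move=> S; apply: valI; apply: uniq; rewrite ?fE ?gE//.
apply: GLSp_continuous => S e e0.
have S0 := opnorm_ge0 (set_val S).
have k0 : 0 < 2 * opnorm (set_val S) + 1 by lra.
(* Within distance 1 of [S], the factor [|S| + |S'|] is at most [2 |S| + 1]. *)
exists (Num.min 1 (e / (2 * opnorm (set_val S) + 1))).
  by rewrite lt_min ltr01 divr_gt0.
move=> S'; rewrite le_min => /andP[d1 de]; rewrite !gE.
rewrite (le_trans (opnorm_sqrB _ _))//.
have S'1 : opnorm (set_val S') <= opnorm (set_val S) + 1.
  have := opnormB (set_val S) (set_val S - set_val S').
  by rewrite opprB addrC subrK => /le_trans; apply; rewrite lerD2l.
move: de; rewrite ler_pdivlMr// mulrC; apply: le_trans.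
rewrite ler_wpM2r ?opnorm_ge0//; lra.
Qed.
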